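(* (i) Let a cyclic quadrilateral with rational side lengths and rational area $n$ be given, with consecutive side lengths $a,b,c,d$. Put $\alpha=\frac{a^2+b^2-c^2+d^2}{2}$. Then $E_{\alpha,-n^2}: y^2=x^3+\alpha x^2-n^2x$ is an elliptic curve over $\mathbb{Q}$, and $$P_1=\left(\frac{(a+c)^2-(b-d)^2}{4},\ a\,\frac{(a+c)^2-(b-d)^2}{4}\right),\qquad P_2=\left(-\frac{(a+d)^2-(b-c)^2}{4},\ b\,\frac{(a+d)^2-(b-c)^2}{4}\right)$$ are two rational points on it, neither of which has order $2$. (ii) Conversely, let $\alpha\in\mathbb{Q}$ and let $n$ be a positive rational number such that the elliptic curve $E_{\alpha,-n^2}: y^2=x^3+\alpha x^2-n^2x$ has positive rank over $\mathbb{Q}$. Then there is a cyclic quadrilateral with area $n$ whose consecutive side lengths $a,b,c,d$ are rational and which corresponds to $E_{\alpha,-n^2}$, i.e. $\frac{a^2+b^2-c^2+d^2}{2}=\alpha$.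
   Context: A cyclic quadrilateral is a (non-degenerate, convex) quadrilateral whose four vertices lie on a circle; all side lengths are positive. Its area is $\sqrt{(s-a)(s-b)(s-c)(s-d)}$ with $s=(a+b+c+d)/2$ (Brahmagupta's formula). The correspondence of the paper attaches to a cyclic quadrilateral with rational consecutive side lengths $a,b,c,d$ and rational area $n$ the curve $E_{\alpha,-n^2}: y^2=x^3+\alpha x^2-n^2x$ with $\alpha=(a^2+b^2-c^2+d^2)/2$. *)

(* Defs.v *)
From HB Require Import structures.
From mathcomp Require Import all_boot all_order all_algebra.
From mathcomp Require Import reals.

Set Implicit Arguments.
Unset Strict Implicit.
Unset Printing Implicit Defensive.

Import Order.TTheory GRing.Theory Num.Theory.

Local Open Scope ring_scope.

(* Long Weierstrass equations
   y^2 + a1 x y + a3 y = x^3 + a2 x^2 + a4 x + a6. *)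
Record weierstrass (F : fieldType) :=
  Weierstrass { wa1 : F; wa2 : F; wa3 : F; wa4 : F; wa6 : F }.

Section WeierstrassCurve.
Variables (F : fieldType) (W : weierstrass F).

Local Notation a1 := (wa1 W).
Local Notation a2 := (wa2 W).
Local Notation a3 := (wa3 W).
Local Notation a4 := (wa4 W).
Local Notation a6 := (wa6 W).

Definition w_b2 : F := a1 ^+ 2 + 4 * a2.
Definition w_b4 : F := 2 * a4 + a1 * a3.
Definition w_b6 : F := a3 ^+ 2 + 4 * a6.
Definition w_b8 : F :=
  a1 ^+ 2 * a6 + 4 * a2 * a6 - a1 * a3 * a4 + a2 * a3 ^+ 2 - a4 ^+ 2.

Definition w_disc : F :=
  - w_b2 ^+ 2 * w_b8 - 8 * w_b4 ^+ 3 - 27 * w_b6 ^+ 2 + 9 * w_b2 * w_b4 * w_b6.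

Definition is_elliptic : Prop := w_disc != 0.

Inductive ec_point : Type := EC_Inf | EC_Aff of F & F.

Definition on_curve (P : ec_point) : Prop :=
  if P is EC_Aff x y then
    y ^+ 2 + a1 * x * y + a3 * y = x ^+ 3 + a2 * x ^+ 2 + a4 * x + a6
  else True.

Definition ec_negY (x y : F) : F := - y - a1 * x - a3.

Definition ec_opp (P : ec_point) : ec_point :=
  if P is EC_Aff x y then EC_Aff x (ec_negY x y) else EC_Inf.

(* Slope of the chord, or of the tangent when the two points coincide; only
   used when the two points are not opposite to each other. *)
Definition ec_slope (x1 y1 x2 y2 : F) : F :=
  if x1 == x2
  then (3 * x1 ^+ 2 + 2 * a2 * x1 + a4 - a1 * y1) / (2 * y1 + a1 * x1 + a3)
  else (y2 - y1) / (x2 - x1).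

(* The chord-and-tangent law; meaningful on points of a nonsingular curve. *)
Definition ec_add (P Q : ec_point) : ec_point :=
  match P, Q with
  | EC_Inf, _ => Q
  | _, EC_Inf => P
  | EC_Aff x1 y1, EC_Aff x2 y2 =>
      if (x1 == x2) && (y1 == ec_negY x2 y2) then EC_Inf
      else
        let l := ec_slope x1 y1 x2 y2 in
        let x3 := l ^+ 2 + a1 * l - a2 - x1 - x2 in
        EC_Aff x3 (ec_negY x3 (l * (x3 - x1) + y1))
  end.

Definition ec_natmul (k : nat) (P : ec_point) : ec_point :=
  iter k (ec_add P) EC_Inf.

Definition ec_intmul (m : int) (P : ec_point) : ec_point :=
  match m with
  | Posz k => ec_natmul k P
  | Negz k => ec_opp (ec_natmul k.+1 P)
  end.

Definition ec_has_order (P : ec_point) (k : nat) : Prop :=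
  [/\ (0 < k)%N, ec_natmul k P = EC_Inf
    & forall j : nat, (0 < j < k)%N -> ec_natmul j P <> EC_Inf].

Definition ec_independent (r : nat) (P : 'I_r -> ec_point) : Prop :=
  forall m : 'I_r -> int,
    \big[ec_add/EC_Inf]_(i < r) ec_intmul (m i) (P i) = EC_Inf ->
    forall i, m i = 0.

(* The rank of the group of F-points is the supremum of the r such that
   [rank_at_least r] holds. *)
Definition rank_at_least (r : nat) : Prop :=
  exists P : 'I_r -> ec_point, (forall i, on_curve (P i)) /\ ec_independent P.

Definition positive_rank : Prop := rank_at_least 1%N.

End WeierstrassCurve.

Arguments EC_Inf {F}.
Arguments EC_Aff {F}.

(* y^2 = x^3 + alpha x^2 + beta x *)
Definition curveE (alpha beta : rat) : weierstrass rat :=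
  Weierstrass 0 alpha 0 beta 0.

Section PlaneGeometry.
Variable R : realType.
Implicit Types A B C D : R * R.

(* The canonical norm on [R * R] is the sup norm, hence this definition. *)
Definition edist A B : R :=
  Num.sqrt ((B.1 - A.1) ^+ 2 + (B.2 - A.2) ^+ 2).

(* Twice the signed area of the triangle A B C. *)
Definition orient A B C : R :=
  (B.1 - A.1) * (C.2 - A.2) - (B.2 - A.2) * (C.1 - A.1).

Definition triangle_area A B C : R := `|orient A B C| / 2.

(* C and D lie strictly on the same side of the line A B. *)
Definition same_side A B C D : Prop := 0 < orient A B C * orient A B D.

(* A, B, C, D are the vertices, in this cyclic order, of a non-degenerate
   convex quadrilateral. *)
Definition convex_quadrilateral A B C D : Prop :=
  [/\ same_side A B C D, same_side B C D A, same_side C D A B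
    & same_side D A B C].

Definition concyclic A B C D : Prop :=
  exists (O : R * R) (r : R), 0 < r /\
    [/\ edist O A = r, edist O B = r, edist O C = r & edist O D = r].

Definition cyclic_quadrilateral A B C D : Prop :=
  convex_quadrilateral A B C D /\ concyclic A B C D.

(* The diagonal A C cuts a convex quadrilateral into two triangles. *)
Definition quadrilateral_area A B C D : R :=
  triangle_area A B C + triangle_area A C D.

Definition has_rational_sides A B C D (a b c d : rat) : Prop :=
  [/\ edist A B = ratr a, edist B C = ratr b, edist C D = ratr c
    & edist D A = ratr d].

Definition has_rational_area A B C D (n : rat) : Prop :=
  quadrilateral_area A B C D = ratr n.

End PlaneGeometry.

Definition quad_alpha (a b c d : rat) : rat :=
  (a ^+ 2 + b ^+ 2 - c ^+ 2 + d ^+ 2) / 2.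

(* Main.v *)
Require Import Defs.
From HB Require Import structures.
From mathcomp Require Import all_boot all_order all_algebra.
From mathcomp Require Import boolp reals.
From mathcomp Require Import ring lra.

Set Implicit Arguments.
Unset Strict Implicit.
Unset Printing Implicit Defensive.

Import Order.TTheory GRing.Theory Num.Theory.

Local Open Scope ring_scope.

(** Both directions rest on Brahmagupta's formula in the form
      16 n^2 = 4 (ab + cd)^2 - (a^2 + b^2 - c^2 - d^2)^2,
    which for positive a, b, c, d, n is equivalent to the existence of a cyclic
    quadrilateral with these sides and area
    ([cyclic_quadrilateral_brahmagupta], [cyclic_quadrilateral_of_brahmagupta]).

    From the quadrilateral to the curve, the formula factors as
    n^2 = u u' = v v', where u and -v are the abscissas of the two points, and
    u' = u + alpha - a^2, v' = v - alpha + b^2.  These factorizations are the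
    equations of the curve at the two points divided by the abscissa; they also
    give u, v <> 0, hence nonzero ordinates, which excludes order 2.

    From the curve to the quadrilateral, look for an isosceles solution a = b.
    A point (x, y) with x, y > 0 yields a = y / x, and putting w = x + n^2 / x
    one has w^2 = (a^2 - alpha)^2 + 4 n^2.  Brahmagupta's formula and the
    condition on alpha are then solved by
      c + d = w / a,    c - d = 2 a (a^2 - alpha) / w.
    Both c and d are positive as soon as a^2 < n ([sides_of_flat_point]), so
    what is needed is a rational point with y^2 < n x^2.  On the part x > 0
    of the curve, y^2 / x^2 vanishes exactly at the point of order 2, so any
    rational point close enough to that point will do.

    Positive rank makes rational points dense in the identity component, which
    is a circle, so such points exist.  The density is proved by hand
    ([flat_point]), by contradiction.  Suppose that y^2 >= n x^2 at all rational
    points with x > 0 and y <> 0.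
    - A point Q of very large abscissa is very close to the origin of the
      group.  Adding Q again and again to a starting point walks around the
      circle towards the point of order 2, each step decreasing the abscissa by
      at least a fixed amount ([sweep_step]).  This cannot go on forever, so
      abscissas of rational points are bounded ([bounded_of_steep]).
    - There are infinitely many rational points, namely the multiples of a point
      of infinite order.  By the pigeonhole principle two of them are very close
      ([close_points]); their difference then has a very large abscissa.
    The multiples of P are pairwise distinct because of the cancellation law
    -P + (P + Q) = Q ([ec_addKl]). *)

(** * Chords, tangents and cancellation *)

Section GroupLaw.
Variables (F : realFieldType) (alpha beta : F).

(** The same equation as [curveE], over any ordered field. *)
Definition curve_ab : weierstrass F := Weierstrass 0 alpha 0 beta 0.
Local Notation W := curve_ab.

Lemma w_disc_curve_ab :
  w_disc W = 16 * beta ^+ 2 * (alpha ^+ 2 - 4 * beta).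
Proof. by rewrite /w_disc /w_b2 /w_b4 /w_b6 /w_b8 /=; ring. Qed.

Lemma on_curveE x y :
  on_curve W (EC_Aff x y) <-> y ^+ 2 = x ^+ 3 + alpha * x ^+ 2 + beta * x.
Proof. by rewrite /= !mul0r !addr0. Qed.

Lemma ec_add_affE x1 y1 x2 y2 :
  ec_add W (EC_Aff x1 y1) (EC_Aff x2 y2) =
  if (x1 == x2) && (y1 == - y2) then EC_Inf else
  let l := if x1 == x2 then (3 * x1 ^+ 2 + 2 * alpha * x1 + beta) / (2 * y1)
           else (y2 - y1) / (x2 - x1) in
  let x3 := l ^+ 2 - alpha - x1 - x2 in
  EC_Aff x3 (- (l * (x3 - x1) + y1)).
Proof.
rewrite /ec_add /ec_slope /ec_negY; cbv zeta; simpl.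
by rewrite !mul0r !subr0 !addr0.
Qed.

Lemma ec_opp_affE x y : ec_opp W (EC_Aff x y) = EC_Aff x (- y).
Proof. by rewrite /= /ec_negY /= mul0r !subr0. Qed.

Lemma ec_opp_on_curve P : on_curve W P -> on_curve W (ec_opp W P).
Proof.
case: P => // x y /on_curveE E; rewrite ec_opp_affE; apply/on_curveE.
by rewrite sqrrN.
Qed.

(** The line of slope [l] through (x1, y1) meets the curve again at abscissa
    [x2], with multiplicity: after substituting the line in the equation and
    dividing by t - x1, [x2] is a root of what remains.  Chords and tangents are
    both covered, and the slope of the tangent is the case x2 = x1. *)
Definition line_meets x1 y1 x2 l :=
  x1 ^+ 2 + x1 * x2 + x2 ^+ 2 + alpha * (x1 + x2) + beta
    = 2 * y1 * l + l ^+ 2 * (x2 - x1).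

Lemma chord_meets x1 y1 x2 y2 l :
  on_curve W (EC_Aff x1 y1) -> on_curve W (EC_Aff x2 y2) ->
  x1 != x2 -> l * (x2 - x1) = y2 - y1 -> line_meets x1 y1 x2 l.
Proof.
move=> /on_curveE E1 /on_curveE E2 ne El.
have dn0 : x2 - x1 != 0 by rewrite subr_eq0 eq_sym.
apply: (mulfI dn0).
have -> : (x2 - x1) * (2 * y1 * l + l ^+ 2 * (x2 - x1)) = y2 ^+ 2 - y1 ^+ 2.
  have -> : y2 = y1 + l * (x2 - x1) by rewrite El; ring.
  by ring.
by rewrite E1 E2; ring.
Qed.

(** The cubic in t that remains after substituting the line has roots x1 and x2,
    and its t^2-coefficient forces the third root to be x3. *)
Lemma third_on_curve x1 y1 x2 l :
  on_curve W (EC_Aff x1 y1) -> line_meets x1 y1 x2 l ->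
  forall x3 : F, x3 = l ^+ 2 - alpha - x1 - x2 ->
  on_curve W (EC_Aff x3 (- (l * (x3 - x1) + y1))).
Proof.
move=> /on_curveE /eqP; rewrite -subr_eq0 => /eqP E1.
move=> /eqP; rewrite -subr_eq0 => /eqP El x3 e3.
apply/on_curveE; apply: subr0_eq.
set g := (X in X = 0) in E1; set h := (X in X = 0) in El.
have -> : (- (l * (x3 - x1) + y1)) ^+ 2
    - (x3 ^+ 3 + alpha * x3 ^+ 2 + beta * x3) = g - (x3 - x1) * h.
  by rewrite /g /h e3; ring.
by rewrite E1 El mulr0 subrr.
Qed.

Lemma same_abscissa x y1 y2 :
  on_curve W (EC_Aff x y1) -> on_curve W (EC_Aff x y2) ->
  y1 != - y2 -> y1 = y2.
Proof.
move=> /on_curveE E1 /on_curveE E2 ne.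
have /eqP : y1 ^+ 2 = y2 ^+ 2 by rewrite E1 E2.
by rewrite eqf_sqr (negPf ne) orbF => /eqP.
Qed.

(** The chord and the tangent case of the addition become a single one, because
    both slopes satisfy [line_meets]. *)
Lemma ec_add_cases P Q (R := ec_add W P Q) :
  on_curve W P -> on_curve W Q ->
  [\/ P = EC_Inf /\ R = Q, Q = EC_Inf /\ R = P, Q = ec_opp W P /\ R = EC_Inf |
  exists x1 y1 x2 y2 l, [/\ P = EC_Aff x1 y1, Q = EC_Aff x2 y2,
    l * (x2 - x1) = y2 - y1, line_meets x1 y1 x2 l &
    let x3 := l ^+ 2 - alpha - x1 - x2 in
    R = EC_Aff x3 (- (l * (x3 - x1) + y1))]].
Proof.
rewrite {}/R.
case: P => [|x1 y1]; first by constructor 1.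
case: Q => [|x2 y2]; first by constructor 2.
move=> H1 H2; rewrite ec_add_affE.
case: ifP => [/andP[/eqP ex /eqP ey]|/negbT nopp].
  by constructor 3; rewrite ec_opp_affE ex ey opprK.
constructor 4; set l := if _ then _ else _.
exists x1, y1, x2, y2, l; split=> //.
- rewrite /l; case: (eqVneq x1 x2) => [ex|ne].
    move: nopp H1; rewrite ex eqxx /= => ny H1.
    by rewrite (same_abscissa H1 H2 ny) !subrr mulr0.
  by rewrite divfK // subr_eq0 eq_sym.
rewrite /l; case: (eqVneq x1 x2) => [ex|ne].
  move: nopp H1; rewrite /line_meets ex eqxx /= => ny H1.
  have e12 := same_abscissa H1 H2 ny.
  have y0 : y1 != 0.
    by move: ny; rewrite -e12; apply: contraNneq => ->; rewrite oppr0.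
  by field.
by apply: (chord_meets H1 H2) => //; rewrite divfK // subr_eq0 eq_sym.
Qed.

Lemma ec_add_on_curve P Q :
  on_curve W P -> on_curve W Q -> on_curve W (ec_add W P Q).
Proof.
move=> HP HQ; case: (ec_add_cases HP HQ)
  => [[_ ->]|[_ ->]|[_ ->]|[x1 [y1 [x2 [y2 [l [eP _ _ Hl ->]]]]]]] //.
by apply: (third_on_curve _ Hl) => //; rewrite -eP.
Qed.

(** A double root of the cubic in x kills the discriminant. *)
Lemma nonsingular x :
  is_elliptic W -> on_curve W (EC_Aff x 0) ->
  3 * x ^+ 2 + 2 * alpha * x + beta != 0.
Proof.
rewrite /is_elliptic w_disc_curve_ab => /eqP D /on_curveE /esym.
rewrite expr0n mulr0n => E; apply/eqP => E'; apply: D.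
have {}E : x * (x ^+ 2 + alpha * x + beta) = 0 by rewrite -E; ring.
move/eqP: E; rewrite mulf_eq0 => /orP[/eqP x0|/eqP g0].
  suff -> : beta = 0 by ring.
  by rewrite -E' x0; ring.
have {}E' : x * (2 * x + alpha) = 0 by rewrite -[RHS](subrr 0) -{1}E' -g0; ring.
move/eqP: E'; rewrite mulf_eq0 => /orP[/eqP x0|/eqP a0].
  suff -> : beta = 0 by ring.
  by rewrite -g0 x0; ring.
have ea : alpha = - (2 * x) by lra.
have -> : beta = x ^+ 2 by apply: subr0_eq; rewrite -g0 ea; ring.
by rewrite ea; ring.
Qed.

(** The line through P, Q and -(P + Q) is, reflected in the x-axis, the line
    through -P, P + Q and -Q.  When P + Q has the abscissa of P, the point is
    that this line is the tangent at P. *)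
Lemma ec_addKl P Q :
  is_elliptic W -> on_curve W P -> on_curve W Q ->
  ec_add W (ec_opp W P) (ec_add W P Q) = Q.
Proof.
move=> ell HP HQ; have HS := ec_add_on_curve HP HQ.
have HP' := ec_opp_on_curve HP.
case: (ec_add_cases HP HQ) => [[-> ->]|[-> ->]|[-> ->]|] //.
- by case: (P) => // x y; rewrite ec_opp_affE ec_add_affE !eqxx.
- by case: (P).
move=> [x1 [y1 [x2 [y2 [l [eP eQ Hl Hm eS]]]]]].
move: HS HP; rewrite eS eP eQ ec_opp_affE.
set x3 := l ^+ 2 - _ - _ - _ => HS HP.
rewrite ec_add_affE; case: (eqVneq x1 x3) => [e13|n13] /=; last first.
  have dn : x3 - x1 != 0 by rewrite subr_eq0 eq_sym.
  have -> : (- (l * (x3 - x1) + y1) - - y1) / (x3 - x1) = - l by field.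
  have -> : (- l) ^+ 2 - alpha - x1 - x3 = x2 by rewrite /x3; ring.
  by congr EC_Aff; rewrite mulNr Hl; ring.
rewrite -e13 subrr mulr0 add0r opprK.
have e2 : x2 = l ^+ 2 - alpha - 2 * x1 by move: e13; rewrite /x3; lra.
(* x1 is a double root for the line of slope l, so l is the tangent slope *)
have slope : 3 * x1 ^+ 2 + 2 * alpha * x1 + beta = 2 * y1 * l.
  apply: subr0_eq; move/eqP: Hm; rewrite -subr_eq0 => /eqP <-.
  by rewrite e2; ring.
have y0 : y1 != 0.
  apply/eqP => y0; move: HP; rewrite y0 => /(nonsingular ell).
  by rewrite slope y0 mulr0 mul0r eqxx.
case: ifP => [/eqP e|_].
  case/eqP: y0; lra.
rewrite slope.
have -> : 2 * y1 * l / (2 * - y1) = - l by field.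
have -> : (- l) ^+ 2 - alpha - x1 - x1 = x2 by rewrite e2; ring.
by congr EC_Aff; rewrite mulNr Hl; ring.
Qed.

(** If iP = jP with i < j, cancel P until 0 = (j - i)P. *)
Lemma ec_natmul_inj P :
  is_elliptic W -> on_curve W P ->
  (forall k, (0 < k)%N -> ec_natmul W k P <> EC_Inf) ->
  injective (fun k => ec_natmul W k P).
Proof.
move=> ell HP nt.
have on k : on_curve W (ec_natmul W k P).
  by elim: k => // k IH; apply: ec_add_on_curve.
have step i j : ec_natmul W i.+1 P = ec_natmul W j.+1 P ->
   ec_natmul W i P = ec_natmul W j P.
  move=> /= /(congr1 (ec_add W (ec_opp W P))).
  by rewrite !ec_addKl.
elim=> [|i IH] [|j] // E.
- by case: (nt j.+1 isT).
- by case: (nt i.+1 isT).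
- by rewrite (IH j (step i j E)).
Qed.

Lemma positive_rank_injective :
  is_elliptic W -> positive_rank W ->
  exists P : nat -> ec_point F, injective P /\ forall k, on_curve W (P k).
Proof.
move=> ell [Q [on indep]]; have HP := on ord0.
exists (fun k => ec_natmul W k (Q ord0)); split.
  apply: ec_natmul_inj => // k k0 E.
  have := indep (fun _ => Posz k).
  rewrite big_ord_recl big_ord0 /= E => /(_ erefl ord0) [] ek.
  by move: k0; rewrite ek.
by elim=> // k IH; apply: ec_add_on_curve.
Qed.

End GroupLaw.

(** * Walking along the identity component *)

Section RealLocus.
Variables (F : realFieldType) (alpha n : F).
Local Notation W := (curve_ab alpha (- n ^+ 2)).

(** The upper half of the identity component of the real locus. *)
Definition upper (x y : F) := [/\ 0 < x, 0 < y & on_curve W (EC_Aff x y)].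

Lemma on_curve_factor (x y : F) : on_curve W (EC_Aff x y) ->
  y ^+ 2 = x * (x ^+ 2 + alpha * x - n ^+ 2).
Proof. by move=> /on_curveE ->; ring. Qed.

Lemma exists_abs_bound :
  exists A : F, [/\ 0 <= A, alpha <= A & - A <= alpha].
Proof.
exists `|alpha|; split; rewrite ?normr_ge0 ?ler_norm //.
by have := ler_norm (- alpha); rewrite normrN; lra.
Qed.

(** From x (x + alpha) >= n^2. *)
Lemma abscissa_lb (A M x y : F) :
  0 < n -> 0 <= A -> alpha <= A -> 0 < x -> x <= M ->
  on_curve W (EC_Aff x y) ->
  n ^+ 2 / (M + A) <= x.
Proof.
move=> n0 A0 Aa x0 xM /on_curve_factor E.
have g0 : 0 <= x ^+ 2 + alpha * x - n ^+ 2.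
  by rewrite -(pmulr_rge0 _ x0) -E sqr_ge0.
rewrite ler_pdivrMr; last lra.
nra.
Qed.

(** The second conclusion factors the cubic along the chord; at t = 0 it gives
    the product of the three abscissas. *)
Lemma chord_third (x1 y1 x2 y2 l : F) :
  on_curve W (EC_Aff x1 y1) -> on_curve W (EC_Aff x2 y2) ->
  x1 != x2 -> l * (x2 - x1) = y2 - y1 ->
  let x3 := l ^+ 2 - alpha - x1 - x2 in
  [/\ on_curve W (EC_Aff x3 (- (l * (x3 - x1) + y1)))
    & forall t, t * (t ^+ 2 + alpha * t - n ^+ 2)
      = (l * (t - x1) + y1) ^+ 2 + (t - x1) * (t - x2) * (t - x3)].
Proof.
move=> H1 H2 ne Hl; have Hm := chord_meets H1 H2 ne Hl.
split=> [|t]; first exact: (third_on_curve H1 Hm).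
move: H1 Hm => /on_curveE /eqP; rewrite -subr_eq0 => /eqP E1 /eqP.
rewrite -subr_eq0 => /eqP El; apply: subr0_eq.
set g := (X in X = 0) in E1; set h := (X in X = 0) in El.
transitivity ((t - x1) * h - g); last by rewrite E1 El mulr0 subrr.
by rewrite /g /h; ring.
Qed.

Lemma ordinate_ub (A x0 x y : F) :
  0 <= A -> alpha <= A -> upper x y -> x <= x0 ->
  y <= 1 + x0 * (x0 ^+ 2 + A * x0).
Proof.
move=> A0 Aa [xp yp /on_curve_factor E] lx.
set B := 1 + _.
have B1 : 1 <= B.
  by rewrite /B lerDl mulr_ge0 ?addr_ge0 ?sqr_ge0 ?mulr_ge0 //; lra.
have y2 : y ^+ 2 <= B ^+ 2.
  rewrite E; apply: (@le_trans _ _ B); last by nra.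
  rewrite /B; apply: (@le_trans _ _ (x * (x0 ^+ 2 + A * x0))).
    by rewrite ler_pM2l //; nra.
  apply: (@le_trans _ _ (x0 * (x0 ^+ 2 + A * x0))); last lra.
  by rewrite ler_wpM2r // addr_ge0 ?sqr_ge0 ?mulr_ge0 //; lra.
by rewrite -(ler_pXn2r (n := 2)) ?nnegrE //; lra.
Qed.

(** Adding a point (X, Y) close to the origin moves a point (x, y) to the third
    point of a steep chord, with its ordinate reversed.  The chord crosses the
    x-axis at t = x - y / l.  If the slope l is large enough, then t is so close
    to x that it still lies to the right of the point of order 2, i.e. the cubic
    is positive at t; comparing signs in its factorization along the chord puts
    the third abscissa to the left of t.  Hence the sum stays in the upper half
    and the abscissa drops by at least y / l. *)
Lemma sweep_step (x0 : F) :
  0 < n -> (forall x y : F, upper x y -> n * x ^+ 2 <= y ^+ 2) -> 0 < x0 ->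
  exists M : F, forall X Y : F, upper X Y -> M <= X ->
  exists2 eps : F, 0 < eps & forall x y : F, upper x y -> x <= x0 ->
  exists x' y' : F, upper x' y' /\ x' <= x - eps.
Proof.
move=> n0 steep x00.
have [A [A0 Aa Am]] := exists_abs_bound.
have [xi xi0 xile] : exists2 xi : F, 0 < xi &
    forall x y, upper x y -> x <= x0 -> xi <= x.
  exists (n ^+ 2 / (x0 + A)) => [|x y [xp yp HP] lx].
    by rewrite divr_gt0 ?exprn_gt0 //; lra.
  exact: abscissa_lb n0 A0 Aa xp lx HP.
have [B B1 yle] : exists2 B : F, 1 <= B &
    forall x y, upper x y -> x <= x0 -> y <= B.
  exists (1 + x0 * (x0 ^+ 2 + A * x0)); last by move=> x y; exact: ordinate_ub.
  by rewrite lerDl mulr_ge0 ?addr_ge0 ?sqr_ge0 ?mulr_ge0 //; lra.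
have Bq : 0 <= B * (2 * x0 + A) / n by rewrite divr_ge0 ?mulr_ge0 //; lra.
(* the slope threshold: y / l < xi keeps t positive, and
   (y / l) (2 x0 + A) < n xi keeps the cubic positive at t *)
have [L L0 LE] : exists2 L : F, 0 < L &
    L * xi = B * (2 * x0 + A) / n + B + xi.
  exists ((B * (2 * x0 + A) / n + B) / xi + 1).
    by rewrite ltr_wpDl // divr_ge0 //; lra.
  by rewrite mulrDl mul1r divfK //; lra.
exists (x0 + 4 * L ^+ 2 + A + n ^+ 2 + 1 + B / L) => X Y [X0 Y0 HQ] XL.
have BY : 0 < B * Y by rewrite mulr_gt0 //; lra.
exists (n * xi ^+ 2 / (B * Y)) => [|x y Hxy lx].
  by rewrite divr_gt0 // mulr_gt0 // exprn_gt0.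
have xix := xile x y Hxy lx; have yB := yle x y Hxy lx.
have sxy := steep x y Hxy; case: Hxy => xp yp HP.
have BL : 0 <= B / L by rewrite divr_ge0 //; lra.
have L2 : 0 <= L ^+ 2 by rewrite sqr_ge0.
have n2 : 0 <= n ^+ 2 by rewrite sqr_ge0.
(* Y / X grows like the square root of X *)
have YL : 2 * L * X <= Y.
  rewrite -(ler_pXn2r (n := 2)) ?nnegrE //; [|nra|lra].
  rewrite (on_curve_factor HQ).
  have -> : (2 * L * X) ^+ 2 = X * (4 * L ^+ 2 * X) by ring.
  rewrite ler_pM2l //.
  have : 0 <= X * (X - 4 * L ^+ 2 - A - n ^+ 2) by rewrite mulr_ge0 //; lra.
  have : 0 <= X * (alpha + A) by rewrite mulr_ge0 //; lra.
  have : 0 <= (X - 1) * n ^+ 2 by rewrite mulr_ge0 //; lra.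
  by lra.
have BLX : B <= L * X.
  have : B / L <= X by lra.
  by rewrite ler_pdivrMr // mulrC.
have Xx : 1 <= X - x by lra.
pose l := (Y - y) / (X - x).
have Hl : l * (X - x) = Y - y by rewrite /l divfK //; apply/eqP; lra.
have Ll : L <= l by rewrite /l ler_pdivlMr; nra.
have l0 : 0 < l by lra.
have lY : l <= Y by rewrite /l ler_pdivrMr; nra.
have neq : x != X by apply/eqP; lra.
have /= [on3 cubic] := chord_third HP HQ neq Hl.
set x3 := l ^+ 2 - alpha - x - X in on3 cubic *.
set y3 := - (l * (x3 - x) + y) in on3.
pose t := x - y / l.
have ly : l * (y / l) = y by rewrite mulrC divfK //; lra.
have yl0 : 0 < y / l by rewrite divr_gt0.
have ylxi : y / l < xi.
  rewrite ltr_pdivrMr //; apply: (@le_lt_trans _ _ B) => //.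
  apply: (@lt_le_trans _ _ (L * xi)); first lra.
  by rewrite mulrC ler_pM2l.
have ylA : (y / l) * (2 * x0 + A) < n * xi.
  rewrite mulrAC ltr_pdivrMr //.
  apply: (@le_lt_trans _ _ (B * (2 * x0 + A))).
    by rewrite ler_wpM2r //; lra.
  apply: (@lt_le_trans _ _ (n * (L * xi))).
    by rewrite LE -ltr_pdivrMl // mulrC; lra.
  have -> : n * xi * l = n * (l * xi) by ring.
  by rewrite ler_pM2l // ler_pM2r.
have t0 : 0 < t by rewrite /t; lra.
have gx : n * xi <= x ^+ 2 + alpha * x - n ^+ 2.
  apply: (@le_trans _ _ (n * x)); first by rewrite ler_pM2l.
  by rewrite -(ler_pM2l xp) -(on_curve_factor HP); lra.
have gt : 0 < t ^+ 2 + alpha * t - n ^+ 2.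
  have : (y / l) * (x + t + alpha) <= (y / l) * (2 * x0 + A).
    by rewrite ler_pM2l // /t; lra.
  have : (y / l) * (x + t + alpha)
    = (x ^+ 2 + alpha * x) - (t ^+ 2 + alpha * t) by rewrite /t; ring.
  by lra.
have y3E : y3 = l * (t - x3) by rewrite /y3 /t !mulrBr ly; ring.
have x3t : x3 < t.
  have := cubic t; have -> : l * (t - x) + y = 0 by rewrite /t !mulrBr ly; ring.
  rewrite expr0n mulr0n add0r => E.
  have : 0 < (t - x) * (t - X) * (t - x3) by rewrite -E mulr_gt0.
  have -> : (t - x) * (t - X) = (y / l) * (X - t) by rewrite /t; ring.
  by rewrite pmulr_rgt0 ?subr_gt0 // mulr_gt0 // subr_gt0 /t; lra.
have y30 : 0 < y3 by rewrite y3E mulr_gt0 // subr_gt0.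
have x30 : 0 < x3.
  rewrite lt_neqAle; apply/andP; split.
    apply/eqP => e; move: on3 => /on_curveE; rewrite -e => E.
    have : 0 < y3 ^+ 2 by rewrite exprn_gt0.
    by rewrite E; lra.
  have := cubic 0; rewrite mul0r => /esym E.
  have xX : 0 < x * X by rewrite mulr_gt0.
  rewrite -(pmulr_rge0 _ xX).
  have -> : x * X * x3 = (l * (0 - x) + y) ^+ 2 by lra.
  by rewrite sqr_ge0.
exists x3, y3; split => //.
apply: (le_trans (ltW x3t)); rewrite /t lerD2l lerN2.
rewrite ler_pdivrMr //.
have -> : y / l * (B * Y) = (y * B) * (Y / l) by ring.
apply: (@le_trans _ _ (y * B * 1)); last first.
  by rewrite ler_wpM2l // ?ler_pdivlMr ?mul1r // mulr_ge0 //; lra.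
rewrite mulr1; apply: (@le_trans _ _ (y ^+ 2)).
  by apply: le_trans sxy; rewrite ler_pM2l // ler_pXn2r // nnegrE; lra.
by rewrite expr2 ler_pM2l.
Qed.

End RealLocus.

(** * A rational point close to the point of order 2 *)

Section FlatPoint.
Variables (F : archiRealFieldType) (alpha n : F).
Local Notation W := (curve_ab alpha (- n ^+ 2)).
Local Notation upper := (upper alpha n).

(** A point of large abscissa would allow infinitely many steps of
    [sweep_step], each lowering the abscissa by the same amount. *)
Lemma bounded_of_steep : 0 < n ->
  (forall x y : F, upper x y -> n * x ^+ 2 <= y ^+ 2) ->
  exists M : F, forall x y : F, upper x y -> x <= M.
Proof.
move=> n0 steep.
have [[x0 [y0 H0]]|none] := pselect (exists x y : F, upper x y); last first.
  by exists 0 => x y Hxy; case: none; exists x, y.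
have [x00 _ _] := H0.
have [M HM] := sweep_step n0 steep x00.
exists M => X Y HXY; rewrite leNgt; apply/negP => /ltW MX.
have [eps eps0 step] := HM X Y HXY MX.
have walk k : exists x y : F, upper x y /\ x <= x0 - k%:R * eps.
  elim: k => [|k [x [y [Hxy lx]]]]; first by exists x0, y0; rewrite mul0r subr0.
  have lx0 : x <= x0.
    by apply: (le_trans lx); rewrite gerBl mulr_ge0 ?ler0n // ltW.
  have [x' [y' [Hxy' lx']]] := step x y Hxy lx0.
  by exists x', y'; split=> //; rewrite -natr1; lra.
have [x [y [[xp _ _] lx]]] := walk (Num.Def.trunc (x0 / eps)).+1.
by have := truncnS_gt (x0 / eps); rewrite ltr_pdivrMr //; lra.
Qed.

(** Translation by the point (0, 0) of order 2, which exchanges the two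
    components of the real locus, applied to the points with x < 0 only. *)
Definition shift_x (x : F) := if 0 < x then x else - n ^+ 2 / x.
Definition shift_y (x y : F) := if 0 < x then y else n ^+ 2 * y / x ^+ 2.

Lemma shift_gt0 x : 0 < n -> x != 0 -> 0 < shift_x x.
Proof.
move=> n0 x0; rewrite /shift_x; case: ifPn => // /negP xn.
have {}xn : x < 0 by rewrite lt_neqAle x0 leNgt; apply/negP.
by rewrite mulNr oppr_gt0 pmulr_rlt0 ?exprn_gt0 // invr_lt0.
Qed.

Lemma shift_on_curve x y : x != 0 ->
  on_curve W (EC_Aff x y) -> on_curve W (EC_Aff (shift_x x) (shift_y x y)).
Proof.
rewrite /shift_x /shift_y; case: ifP => // _ x0 /on_curveE E; apply/on_curveE.
rewrite expr_div_n exprMn E; field.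
by rewrite x0.
Qed.

Lemma shift_y_ge0 x y : 0 < n -> x != 0 -> (0 <= shift_y x y) = (0 <= y).
Proof.
rewrite /shift_y; case: ifP => // _ n0 x0.
by rewrite mulrAC pmulr_rge0 // divr_gt0 ?(exprn_gt0 _ n0) // exprn_even_gt0.
Qed.

Lemma shift_inj x1 x2 : 0 < n -> (0 < x1) = (0 < x2) ->
  shift_x x1 = shift_x x2 -> x1 = x2.
Proof.
rewrite /shift_x => n0 <-; case: ifP => // _.
have nn : - n ^+ 2 != 0 by rewrite oppr_eq0 expf_eq0 gt_eqF.
by move/(mulfI nn)/invr_inj.
Qed.

(** Pigeonhole on the points of P: the buckets record the component, the sign of
    the ordinate, and the abscissa, after translation to the identity component,
    up to 1 / K. *)
Lemma close_points (P : nat -> ec_point F) (M K : nat) :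
  0 < n -> injective P -> (forall k, on_curve W (P k)) ->
  (forall x y : F, 0 < x -> on_curve W (EC_Aff x y) -> x <= M%:R) ->
  exists x1 y1 x2 y2 : F,
    [/\ 0 < x1, 0 < x2, x1 != x2, 0 <= y1 * y2 &
    [/\ on_curve W (EC_Aff x1 y1), on_curve W (EC_Aff x2 y2) &
        `|x1 - x2| * K%:R < 1]].
Proof.
move=> n0 injP onP leM.
(* the two values inl hold one point each, so they cannot see a collision *)
pose bucket (p : ec_point F) : bool + bool * bool * 'I_(M * K).+1 :=
  match p with
  | EC_Inf => inl true
  | EC_Aff x y => if x == 0 then inl false
                  else inr (0 < x, 0 <= y,
                            inord (Num.Def.trunc (shift_x x * K%:R)))
  end.
pose T : finType := (bool + bool * bool * 'I_(M * K).+1)%type.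
have : ~~ injectiveb (fun i : 'I_#|T|.+1 => bucket (P i)).
  apply/negP => /injectiveP /leq_card.
  by rewrite card_ord ltnn.
move=> /injectivePn[i [j ij]].
have nPij : P i <> P j by move=> /injP /val_inj e; rewrite e eqxx in ij.
move: (P i) (P j) (onP i) (onP j) nPij => [|x1 y1] [|x2 y2] on1 on2 ne //=;
  try by case: ifP.
have [x10|x10] := eqVneq x1 0; have [x20|x20] := eqVneq x2 0 => //.
  case: ne; move: on1 on2 => /on_curveE E1 /on_curveE E2; rewrite x10 x20.
  move: E1 E2; rewrite x10 x20 !expr0n !mulr0 !addr0.
  move=> /eqP; rewrite expf_eq0 => /eqP -> /eqP; rewrite expf_eq0 => /eqP -> //.
move=> [sx sy /(congr1 (@nat_of_ord _))].
have nx : x1 != x2.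
  apply/eqP => ex; apply: ne; rewrite ex; congr EC_Aff.
  move: on1 on2; rewrite ex.
  move=> /on_curveE E1 /on_curveE; rewrite -E1 => /eqP; rewrite eqf_sqr.
  case/orP=> /eqP // y12; move: sy; rewrite y12 oppr_ge0.
  by case: (ltgtP 0 y1) => // <- _; rewrite oppr0.
have lt1 x y : x != 0 -> on_curve W (EC_Aff x y) ->
    (Num.Def.trunc (shift_x x * K%:R) < (M * K).+1)%N.
  move=> x0 onx; rewrite truncn_lt_nat ?mulr_ge0 ?ler0n ?ltW ?shift_gt0 //.
  rewrite -natr1 natrM ltr_pwDr // ler_wpM2r ?ler0n //.
  by apply: (leM _ (shift_y x y)); [exact: shift_gt0|exact: shift_on_curve].
rewrite !inordK ?(lt1 _ _ x10 on1) ?(lt1 _ _ x20 on2) // => et.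
exists (shift_x x1), (shift_y x1 y1), (shift_x x2), (shift_y x2 y2); split.
- exact: shift_gt0.
- exact: shift_gt0.
- by apply: contra_neq nx; exact: shift_inj.
- have := shift_y_ge0 y1 n0 x10; have := shift_y_ge0 y2 n0 x20.
  rewrite -sy => <-.
  move=> s12; have [s1|s1] := leP 0 (shift_y x1 y1).
    by rewrite mulr_ge0 // -s12.
  by rewrite nmulr_rge0 // ltW // ltNge -s12 -ltNge.
split; [exact: shift_on_curve|exact: shift_on_curve|].
have pK x : x != 0 -> 0 <= shift_x x * K%:R.
  by move=> x0; rewrite mulr_ge0 ?ler0n // ltW // shift_gt0.
have /andP[a1 a2] := truncn_itv (pK x1 x10).
have /andP[b1 b2] := truncn_itv (pK x2 x20).
rewrite -[K%:R in X in X < _]ger0_norm ?ler0n // -normrM mulrBl ltr_norml.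
move: a1 a2 b1 b2; rewrite et -natr1 => *; apply/andP; split; lra.
Qed.

(** Otherwise all points are steep and abscissas are bounded; but two close
    points P1, P2 with ordinates of the same sign have a difference whose
    abscissa is the square of (y1 + y2) / (x1 - x2), up to bounded terms.
    The numerator is bounded away from 0 because y^2 >= n x^2 and x is bounded
    below, so the abscissa exceeds any bound. *)
Lemma flat_point (P : nat -> ec_point F) :
  0 < n -> injective P -> (forall k, on_curve W (P k)) ->
  exists x y : F, upper x y /\ y ^+ 2 < n * x ^+ 2.
Proof.
move=> n0 injP onP; apply: contrapT => none.
have steep (x y : F) : upper x y -> n * x ^+ 2 <= y ^+ 2.
  by move=> Hxy; rewrite leNgt; apply/negP => lt; apply: none; exists x, y.
have [M0 leM0] := bounded_of_steep n0 steep.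
have [A [A0 Aa Am]] := exists_abs_bound alpha.
(* the bound on abscissas also covers the points with y <= 0 *)
have [M M1 leM] : exists2 M : nat, 1 <= M%:R :> F &
    forall x y : F, 0 < x -> on_curve W (EC_Aff x y) -> x <= M%:R.
  exists (Num.Def.trunc (`|M0| + A + n ^+ 2 + 1)).+1.
    by rewrite ler1n.
  move=> x y x0 Hxy; apply: le_trans (ltW (truncnS_gt _)).
  have M00 := normr_ge0 M0; have M0le := ler_norm M0.
  have n2 : 0 <= n ^+ 2 := sqr_ge0 _.
  have [y0|y0|y0] := ltgtP y 0.
  - have : x <= M0; last lra.
    apply: (leM0 x (- y)); split=> //; first by rewrite oppr_gt0.
    by rewrite -(ec_opp_affE alpha (- n ^+ 2)); apply: ec_opp_on_curve.
  - by have : x <= M0; [apply: (leM0 x y) | lra].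
  have := on_curve_factor Hxy; rewrite y0 expr0n mulr0n => /esym/eqP.
  rewrite mulf_eq0 gt_eqF //= => /eqP E.
  rewrite leNgt; apply/negP => xbig.
  have : 0 <= x * (x - A - n ^+ 2 - 1) by rewrite mulr_ge0 //; lra.
  have : 0 <= x * (alpha + A) by rewrite mulr_ge0 //; lra.
  have : 0 <= (x - 1) * n ^+ 2 by rewrite mulr_ge0 //; lra.
  lra.
have [c c0 low] : exists2 c : F, 0 < c & forall x y : F,
    0 < x -> on_curve W (EC_Aff x y) -> y != 0 -> c <= y ^+ 2.
  have xi0 : 0 < n ^+ 2 / (M%:R + A) by rewrite divr_gt0 ?exprn_gt0 //; lra.
  exists (n * (n ^+ 2 / (M%:R + A)) ^+ 2); first by rewrite mulr_gt0 ?exprn_gt0.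
  move=> x y x0 onx y0.
  have xix := abscissa_lb n0 A0 Aa x0 (leM _ _ x0 onx) onx.
  apply: (@le_trans _ _ (n * x ^+ 2)).
    by rewrite ler_pM2l // ler_pXn2r // nnegrE ltW.
  have [y0'|y0'|y0'] := ltgtP y 0; last by case/eqP: y0.
    rewrite -[y ^+ 2]sqrrN; apply: steep; split=> //; first by rewrite oppr_gt0.
    by rewrite -(ec_opp_affE alpha (- n ^+ 2)); apply: ec_opp_on_curve.
  exact: steep.
pose K := (Num.Def.trunc ((3 * M%:R + A) / c + 1)).+1.
have KK : (3 * M%:R + A) < c * K%:R ^+ 2.
  have := truncnS_gt ((3 * M%:R + A) / c + 1).
  rewrite -/K => lt; have K1 : 1 <= K%:R :> F by rewrite ler1n.
  have : (3 * M%:R + A) / c < K%:R by lra.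
  rewrite ltr_pdivrMr // => lt'.
  apply: (lt_le_trans lt'); rewrite mulrC ler_pM2l //; nra.
have [x1 [y1 [x2 [y2 [x10 x20 ne y12 [on1 on2 close]]]]]] :=
  close_points K n0 injP onP leM.
(* y1 = y2 = 0 is impossible: the curve crosses the positive x-axis once *)
have ys : c <= (y1 + y2) ^+ 2.
  have [y10|y10] := eqVneq y1 0.
    rewrite y10 add0r; apply: (low x2) => //; apply/eqP => y20.
    move: (on_curve_factor on1) (on_curve_factor on2).
    rewrite y10 y20 expr0n mulr0n => /esym/eqP + /esym/eqP.
    rewrite !mulf_eq0 (gt_eqF x10) (gt_eqF x20) /= => /eqP E1 /eqP E2.
    have : (x1 - x2) * (x1 + x2 + alpha) = 0 by lra.
    move/eqP; rewrite mulf_eq0 subr_eq0 (negPf ne) /= => /eqP s0.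
    have : 0 < x1 * x2 by rewrite mulr_gt0.
    have : 0 < n ^+ 2 by rewrite exprn_gt0.
    have ea : alpha = - (x1 + x2) by lra.
    by move: E1; rewrite ea; lra.
  apply: (le_trans (low x1 y1 x10 on1 y10)).
  have : 0 <= y2 ^+ 2 := sqr_ge0 _.
  lra.
pose l := (- y2 - y1) / (x2 - x1).
have d0 : x2 - x1 != 0 by rewrite subr_eq0 eq_sym.
have Hl : l * (x2 - x1) = - y2 - y1 by rewrite divfK.
have on2' : on_curve W (EC_Aff x2 (- y2)).
  by rewrite -(ec_opp_affE alpha (- n ^+ 2)); apply: ec_opp_on_curve.
have /= [on3 _] := chord_third on1 on2' ne Hl.
have l2 : c * K%:R ^+ 2 <= l ^+ 2.
  have -> : l ^+ 2 = (y1 + y2) ^+ 2 / (x2 - x1) ^+ 2 by rewrite /l; field.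
  rewrite ler_pdivlMr ?exprn_even_gt0 //.
  apply: le_trans ys; rewrite -mulrA -exprMn; apply: ler_piMr; first exact: ltW.
  rewrite -[X in X <= _]ger0_norm ?sqr_ge0 // normrX exprn_ile1 //.
  by rewrite normrM distrC ger0_norm ?ler0n // mulrC ltW.
have x1M := leM _ _ x10 on1; have x2M := leM _ _ x20 on2.
have x3M : M%:R < l ^+ 2 - alpha - x1 - x2 by lra.
by have := leM _ _ (lt_trans _ x3M) on3; rewrite leNgt x3M; lra.
Qed.

End FlatPoint.

(** * Brahmagupta's formula *)

(** The right-hand side is the product of the four factors
    - a + b + c + d, a - b + c + d, a + b - c + d, a + b + c - d. *)
Definition brahmagupta (F : realFieldType) (a b c d n : F) : Prop :=
  16 * n ^+ 2 =
    4 * (a * b + c * d) ^+ 2 - (a ^+ 2 + b ^+ 2 - c ^+ 2 - d ^+ 2) ^+ 2.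

Section Brahmagupta.
Variable R : realType.
Implicit Types (A B C D O : R * R) (a b c d n : R).

Lemma edist_sqr A B : edist A B ^+ 2 = (B.1 - A.1) ^+ 2 + (B.2 - A.2) ^+ 2.
Proof. by rewrite sqr_sqrtr // addr_ge0 // sqr_ge0. Qed.

Lemma edist_eq A B r : 0 <= r ->
  (B.1 - A.1) ^+ 2 + (B.2 - A.2) ^+ 2 = r ^+ 2 -> edist A B = r.
Proof. by move=> r0 E; rewrite /edist E sqrtr_sqr ger0_norm. Qed.

Lemma orient_neq0_edist A B C : orient A B C != 0 -> 0 < edist A B.
Proof.
rewrite lt_neqAle sqrtr_ge0 andbT; apply: contra_neq => E.
have := edist_sqr A B; rewrite -E expr0n mulr0n => /esym/eqP.
rewrite paddr_eq0 ?sqr_ge0 // !sqrf_eq0 /orient => /andP[/eqP -> /eqP ->].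
by rewrite !mul0r subrr.
Qed.

Lemma orient_rot A B C : orient B C A = orient A B C.
Proof. by rewrite /orient; ring. Qed.

(** Let p, q be twice the signed areas of ABC and ACD, and s, t the scalar
    products at the vertices B and D.  Then p^2 + s^2 = (ab)^2,
    q^2 + t^2 = (cd)^2, and the law of cosines for the diagonal AC gives
    2 (s - t) = a^2 + b^2 - c^2 - d^2.  Opposite angles of a cyclic
    quadrilateral are supplementary, which reads s q + t p = 0; as p and q have
    the same sign by convexity, p q - s t = abcd follows.  Adding
    (p + q)^2 = 4 n^2 and (s - t)^2 yields the formula. *)
Lemma cyclic_quadrilateral_brahmagupta A B C D :
  cyclic_quadrilateral A B C D ->
  [/\ 0 < edist A B, 0 < edist B C, 0 < quadrilateral_area A B C D &
  brahmagupta (edist A B) (edist B C) (edist C D) (edist D A)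
    (quadrilateral_area A B C D)].
Proof.
move=> [[h1 h2 h3 h4] [O [r [r0 [rA rB rC rD]]]]].
rewrite /brahmagupta.
set a := edist A B; set b := edist B C; set c := edist C D; set d := edist D A.
pose p := orient A B C; pose q := orient A C D.
have pq : 0 < p * q.
  move: h2 h3; rewrite /same_side (orient_rot A B C) (orient_rot B C D).
  rewrite (orient_rot A C D) -/p -/q => h2 h3.
  have : 0 < (p * q) * (orient B C D) ^+ 2 by have := mulr_gt0 h2 h3; lra.
  rewrite pmulr_lgt0 // exprn_even_gt0 //=.
  by apply/eqP => z; move: h2; rewrite z mul0r ltxx.
have pn0 : p != 0 by apply/eqP => z; move: pq; rewrite z mul0r ltxx.
have qn0 : q != 0 by apply/eqP => z; move: pq; rewrite z mulr0 ltxx.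
have a0 : 0 < a := orient_neq0_edist pn0.
have b0 : 0 < b by apply: (@orient_neq0_edist B C A); rewrite orient_rot.
have c0 : 0 < c by apply: (@orient_neq0_edist C D A); rewrite orient_rot.
have d0 : 0 < d.
  by apply: (@orient_neq0_edist D A C); rewrite orient_rot orient_rot.
have area2 : 2 * quadrilateral_area A B C D = `|p + q|.
  rewrite /quadrilateral_area /triangle_area -/p -/q.
  have [p0|p0|p0] := ltgtP p 0; last by rewrite p0 eqxx in pn0.
    have q0 : q < 0 by rewrite -(nmulr_rgt0 _ p0).
    rewrite !ltr0_norm //; lra.
  have q0 : 0 < q by rewrite -(pmulr_rgt0 _ p0).
  rewrite !gtr0_norm //; lra.
have s0 : p + q != 0.
  apply/eqP => z; have e : q = - p by lra.
  by move: pq; rewrite e mulrN oppr_gt0 ltNge -expr2 sqr_ge0.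
have n0 : 0 < quadrilateral_area A B C D.
  have : 0 < `|p + q| by rewrite normr_gt0.
  by rewrite -area2; lra.
split=> //.
have n2 : 4 * quadrilateral_area A B C D ^+ 2 = (p + q) ^+ 2.
  by rewrite -[RHS]real_normK ?num_real // -area2; ring.
pose s := (A.1 - B.1) * (C.1 - B.1) + (A.2 - B.2) * (C.2 - B.2).
pose t := (A.1 - D.1) * (C.1 - D.1) + (A.2 - D.2) * (C.2 - D.2).
have Ea := edist_sqr A B; have Eb := edist_sqr B C.
have Ec := edist_sqr C D; have Ed := edist_sqr D A.
rewrite -/a in Ea; rewrite -/b in Eb; rewrite -/c in Ec; rewrite -/d in Ed.
have psab : p ^+ 2 + s ^+ 2 = (a * b) ^+ 2.
  by rewrite exprMn Ea Eb /p /s /orient; ring.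
have qtcd : q ^+ 2 + t ^+ 2 = (c * d) ^+ 2.
  by rewrite exprMn Ec Ed /q /t /orient; ring.
have K : a ^+ 2 + b ^+ 2 - c ^+ 2 - d ^+ 2 = 2 * (s - t).
  by rewrite Ea Eb Ec Ed /s /t; ring.
(* expand along a column the determinant that vanishes for points of a circle *)
have opp : s * q + t * p = 0.
  transitivity ((edist O D ^+ 2 - r ^+ 2) * orient A B C
     - (edist O C ^+ 2 - r ^+ 2) * orient A B D
     + (edist O B ^+ 2 - r ^+ 2) * orient A C D
     - (edist O A ^+ 2 - r ^+ 2) * orient B C D); last first.
    by rewrite rA rB rC rD; ring.
  by rewrite !edist_sqr /s /t /p /q /orient; ring.
have st : s * t <= 0.
  have : (s * t) * (p * q) <= 0.
    have -> : s * t * (p * q) = - (t * p) ^+ 2.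
      have e : s * q = - (t * p) by lra.
      transitivity ((s * q) * (t * p)); first ring.
      by rewrite e; ring.
    by rewrite oppr_le0 sqr_ge0.
  by rewrite pmulr_lle0.
have pqst : p * q - s * t = a * b * (c * d).
  apply/eqP; rewrite -(eqrXn2 (n := 2)) //; last 2 first.
  - by rewrite subr_ge0; apply: (le_trans st); exact: ltW.
  - by rewrite !mulr_ge0 // ltW.
  apply/eqP; rewrite [RHS]exprMn -psab -qtcd.
  transitivity ((p * q - s * t) ^+ 2 + (s * q + t * p) ^+ 2); last ring.
  by rewrite opp; ring.
by rewrite K; lra.
Qed.

(** The formula prescribes the cosine and the sine of the angles at A and B (the
    sines being 2n / (ad + bc) and 2n / (ab + cd)); the quadrilateral is drawn
    from these two angles on the side AB, placed on the x-axis. *)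
Lemma cyclic_quadrilateral_of_brahmagupta a b c d n :
  0 < a -> 0 < b -> 0 < c -> 0 < d -> 0 < n -> brahmagupta a b c d n ->
  exists A B C D, [/\ cyclic_quadrilateral A B C D,
   [/\ edist A B = a, edist B C = b, edist C D = c & edist D A = d] &
   quadrilateral_area A B C D = n].
Proof.
move=> a0 b0 c0 d0 n0 br.
have p0 : 0 < a * b + c * d by rewrite addr_gt0 ?mulr_gt0.
have q0 : 0 < a * d + b * c by rewrite addr_gt0 ?mulr_gt0.
pose K := a ^+ 2 + b ^+ 2 - c ^+ 2 - d ^+ 2.
pose L := a ^+ 2 + d ^+ 2 - b ^+ 2 - c ^+ 2.
pose cB := K / (2 * (a * b + c * d)).
pose sB := 2 * n / (a * b + c * d).
pose cA := L / (2 * (a * d + b * c)).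
pose sA := 2 * n / (a * d + b * c).
have pn : a * b + c * d != 0 by rewrite gt_eqF.
have qn : a * d + b * c != 0 by rewrite gt_eqF.
have unitB : sB ^+ 2 = 1 - cB ^+ 2.
  have -> : sB ^+ 2 = (16 * n ^+ 2) / (4 * (a * b + c * d) ^+ 2).
    by rewrite /sB; field.
  by rewrite br /cB /K; field.
have unitA : sA ^+ 2 = 1 - cA ^+ 2.
  have -> : sA ^+ 2 = (16 * n ^+ 2) / (4 * (a * d + b * c) ^+ 2).
    by rewrite /sA; field.
  by rewrite br /cA /L; field.
have sB0 : 0 < sB by rewrite divr_gt0 // mulr_gt0.
have sA0 : 0 < sA by rewrite divr_gt0 // mulr_gt0.
pose A : R * R := (0, 0); pose B : R * R := (a, 0).
pose C : R * R := (a - b * cB, b * sB); pose D : R * R := (d * cA, d * sA).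
have oABC : orient A B C = a * b * sB by rewrite /orient /=; ring.
have oDAB : orient D A B = a * d * sA by rewrite /orient /=; ring.
have sAB : sA = sB * (a * b + c * d) / (a * d + b * c).
  by rewrite /sA /sB; field; rewrite pn qn.
have oACD : orient A C D = c * d * sB.
  by rewrite /orient /= sAB /cA /cB /K /L; field; rewrite pn qn.
have oBCD : orient B C D = b * c * sA.
  have -> : orient B C D = orient A B C + orient A C D - orient D A B.
    by rewrite /orient; ring.
  by rewrite oABC oACD oDAB sAB; field.
have o1 : 0 < orient A B C by rewrite oABC (mulr_gt0 (mulr_gt0 a0 b0) sB0).
have o2 : 0 < orient B C D by rewrite oBCD (mulr_gt0 (mulr_gt0 b0 c0) sA0).
have o3 : 0 < orient A C D by rewrite oACD (mulr_gt0 (mulr_gt0 c0 d0) sB0).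
have o4 : 0 < orient D A B by rewrite oDAB (mulr_gt0 (mulr_gt0 a0 d0) sA0).
exists A, B, C, D; split.
- split.
    rewrite /convex_quadrilateral /same_side.
    split; apply: mulr_gt0 => //.
    + by rewrite orient_rot.
    + by rewrite orient_rot.
    + by rewrite orient_rot.
    + by rewrite orient_rot.
    + by rewrite orient_rot orient_rot.
  (* the centre is (a / 2, k), with k chosen so that the circle contains C *)
  pose k := (b - a * cB) / (2 * sB).
  have sBn : sB != 0 by rewrite gt_eqF.
  have kD : d = a * cA + 2 * k * sA.
    have -> : 2 * k * sA = (b - a * cB) * (sA / sB) by rewrite /k; field.
    have -> : sA / sB = (a * b + c * d) / (a * d + b * c).
      by rewrite sAB; field; rewrite qn.
    by rewrite /cA /cB /K /L; field; rewrite pn qn.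
  have kC : b = a * cB + 2 * k * sB by rewrite /k; field.
  have r0 : 0 < (a / 2) ^+ 2 + k ^+ 2.
    by apply: ltr_pwDl; [rewrite exprn_gt0 // divr_gt0 | exact: sqr_ge0].
  exists (a / 2, k), (Num.sqrt ((a / 2) ^+ 2 + k ^+ 2)); split.
    by rewrite sqrtr_gt0.
  split; apply: edist_eq; rewrite ?sqrtr_ge0 // sqr_sqrtr ?ltW //=.
  + by field.
  + by field.
  + transitivity ((a / 2) ^+ 2 + k ^+ 2
      + b * (b * (cB ^+ 2 + sB ^+ 2) - (a * cB + 2 * k * sB))).
      by field.
    by rewrite -kC unitB; ring.
  transitivity ((a / 2) ^+ 2 + k ^+ 2
    + d * (d * (cA ^+ 2 + sA ^+ 2) - (a * cA + 2 * k * sA))).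
    by field.
  by rewrite -kD unitA; ring.
- split.
  + by apply: edist_eq; rewrite ?ltW //=; ring.
  + apply: edist_eq; rewrite ?ltW //= subr0 exprMn unitB; ring.
  + apply: edist_eq; rewrite ?ltW //=.
    have -> : d * sA - b * sB
        = sB * (c * (d ^+ 2 - b ^+ 2) / (a * d + b * c)).
      by rewrite sAB; field.
    by rewrite exprMn unitB /cA /cB /K /L; field; rewrite pn qn.
  + apply: edist_eq; rewrite ?ltW //=.
    transitivity (d ^+ 2 * (cA ^+ 2 + sA ^+ 2)); first by ring.
    by rewrite unitA; ring.
rewrite /quadrilateral_area /triangle_area (gtr0_norm o1) (gtr0_norm o3).
by rewrite oABC oACD /sB; field.
Qed.
End Brahmagupta.

(** * The correspondence *)

Section Correspondence.
Variable F : realFieldType.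
Implicit Types alpha n x y a b c d : F.

Lemma not_order2 (alpha beta x y : F) :
  y != 0 -> ~ ec_has_order (curve_ab alpha beta) (EC_Aff x y) 2.
Proof.
move=> y0 [_ + _]; rewrite /ec_natmul /iter ec_add_affE eqxx /=.
case: ifP => // /eqP ey _; case/eqP: y0; lra.
Qed.

Lemma points_of_brahmagupta a b c d n :
  0 < a -> 0 < b -> 0 < n -> brahmagupta a b c d n ->
  let W := curve_ab ((a ^+ 2 + b ^+ 2 - c ^+ 2 + d ^+ 2) / 2) (- n ^+ 2) in
  let u := ((a + c) ^+ 2 - (b - d) ^+ 2) / 4 in
  let v := ((a + d) ^+ 2 - (b - c) ^+ 2) / 4 in
  let P1 := EC_Aff u (a * u) in
  let P2 := EC_Aff (- v) (b * v) in
  is_elliptic W /\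
  [/\ on_curve W P1, on_curve W P2, P1 <> P2,
      ~ ec_has_order W P1 2 & ~ ec_has_order W P2 2].
Proof.
move=> a0 b0 n0 br W u v P1 P2; rewrite /brahmagupta in br.
have n2 : 0 < n ^+ 2 by rewrite exprn_gt0.
(* Brahmagupta's formula, factored in two ways *)
have uE : n ^+ 2 = u * (((b + d) ^+ 2 - (a - c) ^+ 2) / 4) by rewrite /u; lra.
have vE : n ^+ 2 = v * (((b + c) ^+ 2 - (a - d) ^+ 2) / 4) by rewrite /v; lra.
have u0 : u != 0 by apply: contraTneq n2; rewrite uE => ->; rewrite mul0r ltxx.
have v0 : v != 0 by apply: contraTneq n2; rewrite vE => ->; rewrite mul0r ltxx.
split.
  rewrite /is_elliptic w_disc_curve_ab mulrN opprK.
  set A := (X in X ^+ 2 + _).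
  have A2 : 0 <= A ^+ 2 := sqr_ge0 _.
  by rewrite sqrrN !mulf_neq0 ?expf_neq0 ?gt_eqF //; lra.
split.
- by apply/on_curveE; rewrite uE /u; field.
- by apply/on_curveE; rewrite vE /v; field.
- case=> uv; rewrite uv mulrN => auv.
  have : (a + b) * v = 0 by lra.
  by move/eqP; rewrite mulf_eq0 (negPf v0) orbF gt_eqF // addr_gt0.
- by apply: not_order2; rewrite mulf_neq0 // gt_eqF.
- by apply: not_order2; rewrite mulf_neq0 // gt_eqF.
Qed.

(** Here (a^2 - alpha)^2 + 4 n^2 = w^2 turns the numerators of c and d into
    (alpha - 2 a^2)^2 + 4 n^2 - a^4 and alpha^2 + 4 n^2 - a^4, both positive
    when a^2 < n. *)
Lemma sides_of_flat_point alpha n x y :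
  0 < n -> upper alpha n x y -> y ^+ 2 < n * x ^+ 2 ->
  exists a c d : F, [/\ 0 < a, 0 < c, 0 < d, brahmagupta a a c d n &
    (a ^+ 2 + a ^+ 2 - c ^+ 2 + d ^+ 2) / 2 = alpha].
Proof.
move=> n0 [x0 y0 /on_curve_factor E] flat.
pose a := y / x; pose w := x + n ^+ 2 / x.
have a0 : 0 < a by rewrite divr_gt0.
have w0 : 0 < w by rewrite addr_gt0 // divr_gt0 // exprn_gt0.
have xn : x != 0 by rewrite gt_eqF.
have an : a != 0 by rewrite gt_eqF.
have wn : w != 0 by rewrite gt_eqF.
have Ta : a ^+ 2 - alpha = x - n ^+ 2 / x.
  by rewrite /a expr_div_n E; field.
have w2 : w ^+ 2 = (a ^+ 2 - alpha) ^+ 2 + 4 * n ^+ 2.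
  by rewrite Ta /w; field.
have Tn : a ^+ 2 < n by rewrite /a expr_div_n ltr_pdivrMr // exprn_gt0.
have T0 : 0 < a ^+ 2 by rewrite exprn_gt0.
have n2 : 0 < n ^+ 2 by rewrite exprn_gt0.
have Tn2 : (a ^+ 2) ^+ 2 < n ^+ 2.
  by rewrite ltr_pXn2r // nnegrE ltW.
have aw : 0 < 2 * a * w.
  by apply: mulr_gt0 => //; apply: mulr_gt0.
exists a, ((w / a + 2 * a * (a ^+ 2 - alpha) / w) / 2),
  ((w / a - 2 * a * (a ^+ 2 - alpha) / w) / 2); split => //.
- have -> : (w / a + 2 * a * (a ^+ 2 - alpha) / w) / 2
    = (w ^+ 2 + 2 * a ^+ 2 * (a ^+ 2 - alpha)) / (2 * a * w).
    by field; rewrite an wn.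
  apply: divr_gt0 => //; rewrite w2.
  have := sqr_ge0 (alpha - 2 * a ^+ 2); lra.
- have -> : (w / a - 2 * a * (a ^+ 2 - alpha) / w) / 2
    = (w ^+ 2 - 2 * a ^+ 2 * (a ^+ 2 - alpha)) / (2 * a * w).
    by field; rewrite an wn.
  apply: divr_gt0 => //; rewrite w2.
  have := sqr_ge0 alpha; lra.
- rewrite /brahmagupta.
  transitivity (4 * w ^+ 2 - 4 * (a ^+ 2 - alpha) ^+ 2); last first.
    by field; rewrite an wn.
  by rewrite w2; ring.
by field; rewrite an wn.
Qed.

End Correspondence.

Lemma brahmagupta_ratr (R : realType) (a b c d n : rat) :
  brahmagupta (ratr a : R) (ratr b) (ratr c) (ratr d) (ratr n) <->
  brahmagupta a b c d n.
Proof.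
rewrite /brahmagupta; split=> [E|E].
  apply: (fmorph_inj (ratr : {rmorphism rat -> R})).
  by rewrite !(rmorph_nat, rmorphXn, rmorphB, rmorphD, rmorphM) /=.
have := congr1 (ratr : rat -> R) E.
by rewrite !(rmorph_nat, rmorphXn, rmorphB, rmorphD, rmorphM) /=.
Qed.

Theorem theorem3p1 (R : realType) :
  (forall (A B C D : R * R) (a b c d n : rat),
     cyclic_quadrilateral A B C D ->
     has_rational_sides A B C D a b c d ->
     has_rational_area A B C D n ->
     let W := curveE (quad_alpha a b c d) (- n ^+ 2) in
     let u := ((a + c) ^+ 2 - (b - d) ^+ 2) / 4 in
     let v := ((a + d) ^+ 2 - (b - c) ^+ 2) / 4 in
     let P1 := EC_Aff u (a * u) in
     let P2 := EC_Aff (- v) (b * v) in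
     is_elliptic W /\
     [/\ on_curve W P1, on_curve W P2, P1 <> P2,
         ~ ec_has_order W P1 2 & ~ ec_has_order W P2 2])
  /\
  (forall alpha n : rat,
     0 < n ->
     is_elliptic (curveE alpha (- n ^+ 2)) ->
     positive_rank (curveE alpha (- n ^+ 2)) ->
     exists (A B C D : R * R) (a b c d : rat),
       [/\ cyclic_quadrilateral A B C D,
           has_rational_sides A B C D a b c d,
           has_rational_area A B C D n
         & quad_alpha a b c d = alpha]).
Proof.
split=> [A B C D a b c d n cyc [Ea Eb Ec Ed] En|alpha n n0 ell rk].
  have := cyclic_quadrilateral_brahmagupta cyc.
  rewrite Ea Eb Ec Ed En !ltr0q => -[a0 b0 n0 /brahmagupta_ratr br].
  exact: (points_of_brahmagupta a0 b0 n0 br).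
have [P [injP onP]] : exists P : nat -> ec_point rat,
    injective P /\ forall k, on_curve (curve_ab alpha (- n ^+ 2)) (P k).
  exact: positive_rank_injective ell rk.
have [x [y [Hxy flat]]] := flat_point n0 injP onP.
have [a [c [d [a0 c0 d0 br Ealpha]]]] := sides_of_flat_point n0 Hxy flat.
have [A [B [C [D [cyc sides area]]]]] :
    exists A B C D : R * R, [/\ cyclic_quadrilateral A B C D,
      [/\ edist A B = ratr a, edist B C = ratr a, edist C D = ratr c
        & edist D A = ratr d] & quadrilateral_area A B C D = ratr n].
  apply: cyclic_quadrilateral_of_brahmagupta; rewrite ?ltr0q //.
  exact/brahmagupta_ratr.
by exists A, B, C, D, a, a, c, d.
Qed.
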